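(* For all $n\geq 0$, the number of desarrangements of length $n$ avoiding both $123$ and $132$ is \[ d_n(123,132)=\frac{2^{n+1}+(7-3n)(-1)^n}{9}. \]
   Context: Permutations are in one-line notation; $\mathfrak{S}_0$ consists of the empty permutation, which is considered a desarrangement. An index $i\in[n-1]$ is a descent of $\pi\in\mathfrak{S}_n$ if $\pi_i>\pi_{i+1}$; $i\in[n]$ is an ascent if it is not a descent (so $n$ is always an ascent). A desarrangement is a permutation whose first ascent is even. $d_n(\Pi)$ is the number of desarrangements in $\mathfrak{S}_n$ avoiding every pattern in $\Pi$ ($\pi$ avoids $\sigma$ if no subsequence of $\pi$ has the same relative order as $\sigma$). *)

(* Defs.v *)
From HB Require Import structures.
From mathcomp Require Import all_boot all_order all_algebra all_fingroup.

Set Implicit Arguments.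
Unset Strict Implicit.
Unset Printing Implicit Defensive.

Definition one_line (n : nat) (s : 'S_n) : seq nat :=
  [seq (s i).+1 | i <- enum 'I_n].

(* Positions in a word are numbered from 1, as in one-line notation. *)
Definition entry (w : seq nat) (i : nat) : nat := nth 0 w i.-1.

Definition descent (w : seq nat) (i : nat) : bool :=
  (1 <= i < size w) && (entry w i.+1 < entry w i).

Definition ascent (w : seq nat) (i : nat) : bool :=
  (1 <= i <= size w) && ~~ descent w i.

(* A nonempty word always has an ascent, namely its last position; the empty
   word has none and is treated separately in [desarrangement]. *)
Definition first_ascent (w : seq nat) : nat :=
  (find (ascent w) (iota 1 (size w))).+1.

Definition desarrangement (n : nat) (s : 'S_n) : bool :=
  (n == 0) || ~~ odd (first_ascent (one_line s)).

Definition same_relative_order (u v : seq nat) : bool :=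
  (size u == size v) &&
  [forall i : 'I_(size u), forall j : 'I_(size u),
     (nth 0 u i < nth 0 u j) == (nth 0 v i < nth 0 v j)].

(* Every subsequence of a word of length n is selected by a bit mask. *)
Definition avoids (n : nat) (s : 'S_n) (p : seq nat) : bool :=
  [forall m : n.-tuple bool, ~~ same_relative_order (mask m (one_line s)) p].

Definition num_desarrangements (n : nat) (Pi : seq (seq nat)) : nat :=
  #|[set s : 'S_n | desarrangement s && all (avoids s) Pi]|.

(* Main.v *)
(** A permutation avoids 123 and 132 exactly when every entry has at most one
    larger entry to its right.  Hence it is obtained from an avoiding
    permutation of length one less by prepending either the new maximum or the
    new second largest value.  Prepending the maximum lengthens the initial
    descending run by one; so does prepending the second largest value, unless
    the shorter permutation starts with its maximum, in which case the first
    ascent becomes 1.  The numbers of avoiding permutations, split by whether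
    they start with their maximum and by the parity of the first ascent,
    therefore satisfy a linear recurrence, which is solved explicitly. *)
Require Import Defs.
From HB Require Import structures.
From mathcomp Require Import all_boot all_order all_algebra all_fingroup.
From mathcomp Require Import zify ring.

Import GRing.Theory.
Local Open Scope ring_scope.

Section Words.
Set Implicit Arguments.
Unset Strict Implicit.
Local Arguments first_ascent : simpl never.
Local Arguments odd : simpl never.
Local Open Scope nat_scope.

(** * Words whose entries have at most one larger entry to their right *)

Fixpoint at_most_one_larger (w : seq nat) : bool :=
  if w is x :: w' then (count (ltn x) w' <= 1) && at_most_one_larger w'
  else true.

(** [bump m] turns the maximum [m] of a shorter word into [m.+1] and fixes the rest, which frees the
    value [m] for the new head. A word of length 1 has no second largest value, hence the empty list
    for [m = 0]. *)
Fixpoint avoiding_words (n : nat) : seq (seq nat) :=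
  if n is m.+1 then
    [seq m.+1 :: w | w <- avoiding_words m] ++
    (if m is 0 then [::]
     else [seq m :: map (bump m) w | w <- avoiding_words m])
  else [:: [::]].

Lemma avoiding_wordsSS n : avoiding_words n.+2 =
  [seq n.+2 :: w | w <- avoiding_words n.+1] ++
  [seq n.+1 :: map (bump n.+1) w | w <- avoiding_words n.+1].
Proof. by []. Qed.

Lemma ltn_bump2 h i j : (bump h i < bump h j) = (i < j).
Proof. by rewrite /bump; lia. Qed.

Lemma at_most_one_larger_map f w : {mono f : x y / x < y} ->
  at_most_one_larger (map f w) = at_most_one_larger w.
Proof.
move=> fM; elim: w => //= x w ->; rewrite count_map.
by congr ((_ <= 1) && _); apply: eq_count => y /=; rewrite fM.
Qed.

Lemma at_most_one_largerP w : uniq w ->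
  reflect (forall a b c, subseq [:: a; b; c] w ->
             ~~ ((a < b) && (a < c)))
          (at_most_one_larger w).
Proof.
elim: w => [|x w IHw] /=; first by left.
case/andP=> xNw uw; apply: (iffP andP) => [[cx /(IHw uw) IH] a b c | H].
  case: eqP => [->|_]; last exact: IH.
  move=> sbc; apply/negP => /andP[xb xc].
  have := leq_count_subseq (ltn x) sbc.
  by rewrite /= xb xc; lia.
split; last first.
  apply/(IHw uw) => a b c s; apply: H.
  by case: eqP => [_|//]; apply: subseq_trans s; apply: subseq_cons.
(* If two entries of [w] exceed [x], the first two of them form with [x] an excluded subsequence. *)
rewrite leqNgt; apply/negP; rewrite -size_filter => sz.
case E: (filter (ltn x) w) sz => [|b [|c l]] // _.
have: all (ltn x) (filter (ltn x) w) by apply: filter_all.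
rewrite E /= => /and3P[xb xc _].
have := H x b c; rewrite eqxx xb xc => /(_ _)/negP; apply=> //.
apply: subseq_trans (filter_subseq (ltn x) w); rewrite E.
by rewrite /= !eqxx sub0seq.
Qed.

(** * Translation of pattern avoidance *)

Lemma same_relative_order123 u : same_relative_order u [:: 1; 2; 3] =
  if u is [:: a; b; c] then a < b < c else false.
Proof.
case: u => [|a [|b [|c [|d u]]]] //; rewrite /same_relative_order ?andFb //=.
apply/forallP/idP => [H | abc].
  have /forallP/(_ (@Ordinal 3 1 isT))/eqP/= h1 := H (@Ordinal 3 0 isT).
  have /forallP/(_ (@Ordinal 3 2 isT))/eqP/= h2 := H (@Ordinal 3 1 isT).
  by rewrite h1 h2.
move=> [i ilt]; apply/forallP => -[j jlt] /=; apply/eqP.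
case: i ilt => [|[|[|i]]] // _; case: j jlt => [|[|[|j]]] // _ /=; lia.
Qed.

Lemma same_relative_order132 u : same_relative_order u [:: 1; 3; 2] =
  if u is [:: a; b; c] then a < c < b else false.
Proof.
case: u => [|a [|b [|c [|d u]]]] //; rewrite /same_relative_order ?andFb //=.
apply/forallP/idP => [H | abc].
  have /forallP/(_ (@Ordinal 3 2 isT))/eqP/= h1 := H (@Ordinal 3 0 isT).
  have /forallP/(_ (@Ordinal 3 1 isT))/eqP/= h2 := H (@Ordinal 3 2 isT).
  by rewrite h1 h2.
move=> [i ilt]; apply/forallP => -[j jlt] /=; apply/eqP.
case: i ilt => [|[|[|i]]] // _; case: j jlt => [|[|[|j]]] // _ /=; lia.
Qed.

Lemma size_one_line n (s : 'S_n) : size (one_line s) = n.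
Proof. by rewrite size_map size_enum_ord. Qed.

Lemma perm_one_line n (s : 'S_n) : perm_eq (one_line s) (iota 1 n).
Proof.
apply: uniq_perm; rewrite ?iota_uniq //.
  rewrite map_inj_uniq ?enum_uniq // => i j [] /val_inj; exact: perm_inj.
move=> k; rewrite mem_iota; apply/mapP/idP => [[i _ ->] | ].
  by have := ltn_ord (s i); lia.
case: k => // k /andP[_]; rewrite add1n ltnS => kn.
by exists (s^-1 (Ordinal kn))%g; rewrite ?mem_enum // permKV.
Qed.

Lemma one_line_inj n : injective (@one_line n).
Proof.
move=> s t /eq_in_map st; apply/permP => i; apply: val_inj.
by have [] := st i (mem_enum _ _).
Qed.

Lemma avoidsP n (s : 'S_n) p :
  reflect (forall u, subseq u (one_line s) -> ~~ same_relative_order u p)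
          (avoids s p).
Proof.
apply: (iffP forallP) => [H u /subseqP[m sm ->] | H m].
  have sz : size m == n by rewrite sm size_one_line.
  exact: (H (Tuple sz)).
exact/H/mask_subseq.
Qed.

(** Entries are distinct, so a triple whose first entry is the smallest has the order of 123 or of
    132. *)
Lemma avoids_123_132 n (s : 'S_n) :
  all (avoids s) [:: [:: 1; 2; 3]; [:: 1; 3; 2]] =
  at_most_one_larger (one_line s).
Proof.
have us : uniq (one_line s) by rewrite (perm_uniq (perm_one_line s)) iota_uniq.
rewrite /= andbT; apply/andP/(at_most_one_largerP us).
  move=> [/avoidsP H1 /avoidsP H2] a b c sub.
  have := H1 _ sub; have := H2 _ sub.
  rewrite same_relative_order123 same_relative_order132.
  by have := subseq_uniq sub us; rewrite /= !inE; lia.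
move=> H; split; apply/avoidsP => u sub.
  rewrite same_relative_order123.
  by case: u sub => [|a [|b [|c [|d u]]]] // /H; lia.
rewrite same_relative_order132.
by case: u sub => [|a [|b [|c [|d u]]]] // /H; lia.
Qed.

(** * The recursive list enumerates the avoiding permutations *)

Lemma uniq_avoiding_words n : uniq (avoiding_words n).
Proof.
elim: n => // n IHn /=; rewrite cat_uniq map_inj_uniq ?IHn; last first.
  by move=> ? ? [].
case: n IHn => [|n] IHn //; rewrite map_inj_uniq ?IHn ?andbT; last first.
  by move=> u v [] /(inj_map (can_inj (bumpK _))).
apply/hasPn => _ /mapP[w _ ->]; apply/negP => /mapP[w' _ [/eqP]].
by rewrite eqn_leq ltnn andbF.
Qed.

Lemma iotaSr m n : iota m n.+1 = rcons (iota m n) (m + n).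
Proof. by rewrite -addn1 iotaD cats1. Qed.

Lemma perm_max n w : perm_eq (n.+1 :: w) (iota 1 n.+1) = perm_eq w (iota 1 n).
Proof.
by rewrite iotaSr add1n perm_sym perm_rcons perm_cons perm_sym.
Qed.

Lemma perm_bump n w :
  perm_eq (n.+1 :: map (bump n.+1) w) (iota 1 n.+2) = perm_eq w (iota 1 n.+1).
Proof.
have E : perm_eq (iota 1 n.+2) (n.+1 :: map (bump n.+1) (iota 1 n.+1)).
  rewrite !iotaSr map_rcons !add1n.
  have -> : map (bump n.+1) (iota 1 n) = iota 1 n.
    rewrite -[RHS]map_id; apply/eq_in_map => i; rewrite mem_iota /bump; lia.
  have -> : bump n.+1 n.+1 = n.+2 by rewrite /bump; lia.
  rewrite perm_rcons perm_sym -rcons_cons perm_rcons perm_cons.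
  by rewrite perm_sym perm_rcons.
rewrite perm_sym (permPl E) perm_cons perm_sym.
apply/idP/idP; last exact: perm_map.
exact/perm_map_inj/(can_inj (bumpK _)).
Qed.

(** All values above the head of a permutation stand to its right, so the head must be one of the
    two largest values. *)
Lemma mem_avoiding_words n w : (w \in avoiding_words n) =
  perm_eq w (iota 1 n) && at_most_one_larger w.
Proof.
elim: n w => [|n IHn] w.
  rewrite /= inE; case: w => // x w; apply/esym/negP => /andP[/perm_size //].
apply/idP/andP.
  rewrite /= mem_cat => /orP[/mapP[v vL ->] |].
    move: vL; rewrite IHn => /andP[pv av].
    rewrite perm_max /= av andbT; split => //.
    rewrite (@eq_in_count _ _ pred0) ?count_pred0 // => x.
    by rewrite (perm_mem pv) mem_iota /=; lia.
  case: n IHn => // n IHn /mapP[v]; rewrite IHn => /andP[pv av] ->.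
  rewrite perm_bump /= at_most_one_larger_map ?av ?andbT; last first.
    by move=> x y; apply: ltn_bump2.
  (* Only the maximum of [v], bumped to [n.+2], exceeds the new head [n.+1]. *)
  split => //; rewrite count_map (seq.permP pv) iotaSr -cats1 count_cat.
  rewrite (@eq_in_count _ _ pred0) ?count_pred0 /= => [|x]; first by lia.
  by rewrite mem_iota /bump /=; lia.
case: w => [|x w] [/[dup] pw /perm_size //=] _ /andP[cx aw].
have xw : x \in iota 1 n.+1 by rewrite -(perm_mem pw) mem_head.
have cE : count (ltn x) w = n.+1 - x.
  have -> : count (ltn x) w = count (ltn x) (x :: w) by rewrite /= ltnn.
  rewrite (seq.permP pw).
  have -> : iota 1 n.+1 = iota 1 x ++ iota x.+1 (n.+1 - x).
    by move: xw; rewrite mem_iota -iotaD => xw; congr iota; lia.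
  rewrite count_cat (@eq_in_count _ _ pred0) ?count_pred0; last first.
    by move=> y; rewrite mem_iota /=; lia.
  rewrite (@eq_in_count _ _ predT) ?count_predT ?size_iota //.
  by move=> y; rewrite mem_iota /=; lia.
rewrite mem_cat; have [xE|xE] := eqVneq x n.+1.
  by rewrite xE map_f // IHn aw andbT -perm_max -{1}xE pw.
apply/orP; right; move: xw; rewrite mem_iota => xw.
case: n IHn pw xw cE xE => [|n] IHn pw xw cE xE; first by lia.
have xn : x = n.+1 by lia.
move: pw; rewrite {}xn in cx cE xE * => pw.
have nw : n.+1 \notin w.
  by have := perm_uniq pw; rewrite iota_uniq /= => /andP[].
(* As [n.+1] does not occur in [w], closing the gap at this value and reopening it gives back
   [w]. *)
have wE : w = map (bump n.+1) (map (unbump n.+1) w).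
  rewrite -map_comp -[LHS]map_id; apply/eq_in_map => y yw /=.
  by rewrite unbumpK // inE; apply: contraNneq nw => <-.
rewrite wE map_f // IHn -perm_bump -wE pw /=.
rewrite -(@at_most_one_larger_map (bump n.+1)) -?wE // => y z.
exact: ltn_bump2.
Qed.

Lemma num_desarrangementsE n :
  num_desarrangements n [:: [:: 1; 2; 3]; [:: 1; 3; 2]] =
  count (fun w => (n == 0) || ~~ odd (first_ascent w)) (avoiding_words n).
Proof.
(* Surjectivity follows from injectivity, as both lists have n! members. *)
have olT : [seq one_line s | s : 'S_n] =i permutations (iota 1 n).
  apply: (uniq_min_size _ _ _).2.
  - by rewrite map_inj_uniq ?enum_uniq //; exact: one_line_inj.
  - by move=> _ /mapP[s _ ->]; rewrite mem_permutations perm_one_line.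
  - rewrite size_permutations ?iota_uniq // size_iota size_map -cardT.
    by rewrite card_Sn.
rewrite /num_desarrangements cardE -(size_map (@one_line n)) -size_filter.
apply/perm_size/uniq_perm.
- by rewrite map_inj_uniq ?enum_uniq //; exact: one_line_inj.
- by rewrite filter_uniq ?uniq_avoiding_words.
move=> w; rewrite mem_filter mem_avoiding_words.
apply/mapP/and3P => [[s] | [dw pw aw]].
  rewrite mem_enum inE avoids_123_132 => /andP[ds av] ->.
  by split=> //; exact: perm_one_line.
have := olT w; rewrite mem_permutations pw => /mapP[s _ wE].
exists s => //.
by rewrite mem_enum inE avoids_123_132 -wE aw /desarrangement -wE dw.
Qed.

(** * The first ascent after prepending an entry *)

Lemma first_ascent_cons x y w : first_ascent [:: x, y & w] =
  if y < x then (first_ascent (y :: w)).+1 else 1.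
Proof.
have E : find (ascent [:: x, y & w]) (iota 2 (size w).+1)
       = find (ascent (y :: w)) (iota 1 (size w).+1).
  rewrite (iotaDl 1 1) find_map; apply: eq_in_find => -[|i].
    by rewrite mem_iota.
  by rewrite /ascent /descent /entry /= add1n.
have A1 : ascent [:: x, y & w] 1 = ~~ (y < x).
  by rewrite /ascent /descent /entry.
have -> : first_ascent [:: x, y & w] =
    (if ascent [:: x, y & w] 1 then 0
     else (find (ascent [:: x, y & w]) (iota 2 (size w).+1)).+1).+1 by [].
by rewrite A1 E; case: ltnP.
Qed.

Lemma first_ascent_map f w : {mono f : x y / x < y} ->
  first_ascent (map f w) = first_ascent w.
Proof.
move=> fM; elim: w => [|x [|y w] IHw] //.
by rewrite /= !first_ascent_cons fM -IHw.
Qed.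

(** * The refined counts and their recurrence *)

Definition head_parity_count (h e : bool) (n : nat) : nat :=
  count (fun w => ((head 0 w == n) == h) && (odd (first_ascent w) == e))
        (avoiding_words n).

Lemma head_parity_countD e n :
  head_parity_count true e n + head_parity_count false e n =
  count (fun w => odd (first_ascent w) == e) (avoiding_words n).
Proof.
rewrite /head_parity_count; elim: (avoiding_words n) => //= w l.
by case: (head 0 w == n); case: (_ == e) => /=; lia.
Qed.

Lemma avoiding_words_cons n w : w \in avoiding_words n.+1 ->
  exists x v, [/\ w = x :: v, x <= n.+1 & x != 0].
Proof.
rewrite mem_avoiding_words; case: w => [|x v] /andP[pw _].
  by have := perm_size pw.
exists x, v; have := perm_mem pw x; rewrite mem_head mem_iota.
by move=> /esym/andP[x0 xn]; split=> //; lia.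
Qed.

(** A prepended maximum is followed by a descent, so the first ascent moves by one and its parity
    flips. *)
Lemma head_parity_count_max e n :
  head_parity_count true e n.+2 =
  head_parity_count true (~~ e) n.+1 + head_parity_count false (~~ e) n.+1.
Proof.
rewrite head_parity_countD /head_parity_count.
rewrite avoiding_wordsSS count_cat !count_map.
rewrite [X in _ + X](@eq_count _ _ pred0) ?count_pred0 ?addn0; last first.
  by move=> w /=; apply/negP; lia.
apply: eq_in_count => w /avoiding_words_cons[x [v [-> xn _]]] /=.
rewrite eqxx first_ascent_cons ltnS xn oddS /=.
by case: e; case: odd.
Qed.

(** If the shorter word starts with its maximum, the new first ascent is 1, which is odd whatever
    the old parity: hence the term with factor [e]. Otherwise the parity flips. *)
Lemma head_parity_count_nonmax e n :
  head_parity_count false e n.+2 = head_parity_count false (~~ e) n.+1 +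
  e * (head_parity_count true true n.+1 + head_parity_count true false n.+1).
Proof.
rewrite /head_parity_count avoiding_wordsSS count_cat !count_map.
rewrite [X in X + _](@eq_count _ _ pred0) ?count_pred0 ?add0n; last first.
  by move=> w /=; rewrite eqxx.
have key w : w \in avoiding_words n.+1 ->
    odd (first_ascent (n.+1 :: map (bump n.+1) w)) =
    (head 0 w == n.+1) || ~~ odd (first_ascent w).
  move=> /avoiding_words_cons[x [v [-> xn _]]] /=.
  rewrite first_ascent_cons -map_cons first_ascent_map; last first.
    by move=> ? ?; exact: ltn_bump2.
  have -> : (bump n.+1 x < n.+1) = (x != n.+1) by rewrite /bump; lia.
  by case: eqP.
rewrite (@eq_in_count _ _ (fun w =>
    ((head 0 w == n.+1) || ~~ odd (first_ascent w)) == e)); last first.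
  move=> w wL /=; rewrite key //.
  by have -> : (n.+1 == n.+2) = false by lia.
elim: (avoiding_words n.+1) => [|w l] /=; first by case: e.
by case: e; case: (head 0 w == n.+1); case: odd => /=; lia.
Qed.

End Words.

(** * Solution of the recurrence *)

(** The transition matrix has eigenvalues 2, -1 (double) and 0. The double one produces the factor
    linear in [n]; because of the eigenvalue 0 the formulas fail at length 1 and start at length
    2. *)
Lemma head_parity_count_closed (n : nat) :
  [/\ (head_parity_count true false n.+2)%:R
        = (5 * 2 ^+ n + (4 - 3 * n%:R) * (-1) ^+ n) / 9 :> rat,
      (head_parity_count true true n.+2)%:R
        = (4 * 2 ^+ n - (4 - 3 * n%:R) * (-1) ^+ n) / 9 :> rat,
      (head_parity_count false false n.+2)%:R
        = (2 ^+ n - (-1) ^+ n) / 3 :> rat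
    & (head_parity_count false true n.+2)%:R
        = (2 * 2 ^+ n + (-1) ^+ n) / 3 :> rat].
Proof.
elim: n => [|n [IH1 IH2 IH3 IH4]]; first by split.
rewrite !(head_parity_count_max _ n.+1) !(head_parity_count_nonmax _ n.+1).
rewrite /= mul0n mul1n !natrD IH1 IH2 IH3 IH4 !exprS -natr1.
by split; field.
Qed.

Theorem theorem3p19 (n : nat) :
  (num_desarrangements n [:: [:: 1; 2; 3]; [:: 1; 3; 2]]%N)%:R
  = (2 ^+ n.+1 + (7 - 3 * n%:R) * (-1) ^+ n) / 9 :> rat.
Proof.
rewrite num_desarrangementsE.
(* Lengths 0 and 1 lie below the range of the closed forms; the counts 1 and 0 are computed. *)
case: n => [|[|n]] //.
have [E0 _ E1 _] := head_parity_count_closed n.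
rewrite (@eq_count _ _ (fun w => odd (first_ascent w) == false)); last first.
  by move=> w /=; case: odd.
rewrite -head_parity_countD natrD E0 E1 !exprS -addn2 natrD.
by field.
Qed.
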